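(* Let $X$ and $Y$ be real Banach spaces, let $A$ be an open subset of $X$, let $J : A \rightarrow \mathbb{R}$ be a functional and let $f : A \rightarrow Y$ be a mapping. Let $\hat{x} \in A$ be a local solution of the problem of maximizing $J(x)$ subject to $x \in A$, $f(x) = 0$. Assume that the following conditions are fulfilled. (a) $J$ is Fréchet differentiable at $\hat{x}$ and $f$ is of class $C^1$ on a neighborhood of $\hat{x}$. (b) $E_2 := \mathrm{Ker}\, Df(\hat{x})$ is topologically complemented in $X$, i.e. $X = E_1 \oplus E_2$ where $E_1$ is a closed vector subspace of $X$; and $F_1 := \mathrm{Im}\, Df(\hat{x})$ is closed and topologically complemented in $Y$, i.e. $Y = F_1 \oplus F_2$ where $F_2$ is a closed vector subspace of $Y$. (c) There exists an open neighborhood $A_0$ of $\hat{x}$ in $A$ (on which $f$ is differentiable) such that, for all $x \in A_0$, $\mathrm{Im}\, Df(x) \cap F_2 = \{0\}$. Then there exists $\lambda \in Y^*$ such that $DJ(\hat{x}) = \lambda \circ Df(\hat{x})$.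
   Context: $D$ denotes Fréchet differentiation, and $Y^*$ is the topological dual of $Y$. The symbol $\oplus$ denotes topological direct sum: $E = E_1 \oplus E_2$ with $E_1, E_2$ closed vector subspaces means that $(x_1,x_2) \mapsto x_1 + x_2$ is an isomorphism of topological vector spaces from $E_1 \times E_2$ onto $E$. A local solution is a point $\hat{x} \in A$ with $f(\hat{x}) = 0$ for which there is a neighborhood $U$ of $\hat{x}$ in $A$ such that $J(x) \leq J(\hat{x})$ for all $x \in U$ with $f(x) = 0$. *)

(* Defs.v *)
From HB Require Import structures.
From mathcomp Require Import all_boot all_order all_algebra.
From mathcomp Require Import all_classical all_reals all_analysis.
Set Implicit Arguments.
Unset Strict Implicit.
Unset Printing Implicit Defensive.
Import Order.TTheory GRing.Theory Num.Theory.
Import numFieldNormedType.Exports.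
Local Open Scope classical_set_scope.
Local Open Scope ring_scope.

Definition closed_subspace (R : realType) (V : normedModType R) (E : set V) :=
  submod_closed (mem E) /\ closed E.

(* The witness [g] is the continuous inverse of the addition map
   [E1 `*` E2 -> V]; linearity of both maps is automatic. *)
Definition topological_direct_sum (R : realType) (V : normedModType R)
    (E1 E2 : set V) :=
  let add := fun p : V * V => p.1 + p.2 in
  [/\ closed_subspace E1,
      closed_subspace E2,
      {within E1 `*` E2, continuous add} &
      exists g : V -> V * V,
        [/\ forall v, (E1 `*` E2) (g v),
            forall p, (E1 `*` E2) p -> g (add p) = p,
            forall v, add (g v) = v &
            continuous g]].

(* [sup] is the expected supremum only for bounded [L]; on unbounded [L] it
   returns 0. Below it is applied to differences of differentials of a
   differentiable function, which are bounded. *)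
Definition opnorm (R : realType) (V W : normedModType R) (L : V -> W) : R :=
  sup [set `|L h| | h in [set h : V | `|h| <= 1]].

(* The differential is continuous on the open set [U] for the operator norm. *)
Definition class_C1_on (R : realType) (V W : normedModType R)
    (f : V -> W) (U : set V) :=
  [/\ open U,
      forall x, U x -> differentiable f x &
      forall x, U x -> opnorm ('d f z \- 'd f x) @[z --> x] --> (0 : R)].

(* Functions on the set [A] are represented by total functions whose values
   outside [A] are irrelevant. *)
Definition local_solution (R : realType) (X Y : normedModType R) (A : set X)
    (J : X -> R) (f : X -> Y) (xhat : X) :=
  [/\ A xhat, f xhat = 0 &
      \forall x \near within A (nbhs xhat), f x = 0 -> J x <= J xhat].

(* Main.v *)
Require Import Defs.
From HB Require Import structures.
From mathcomp Require Import all_boot all_order all_algebra.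
From mathcomp Require Import all_classical all_reals all_analysis.
From mathcomp Require Import ring lra.
Import Order.TTheory GRing.Theory Num.Theory.
Import numFieldNormedType.Exports.
Set Implicit Arguments.
Unset Strict Implicit.
Unset Printing Implicit Defensive.
Local Open Scope classical_set_scope.
Local Open Scope ring_scope.

(* Write [T] for the differential of [f] at [xhat]. The two splittings and the
   open mapping theorem give a bounded linear [S : Y -> X] with kernel [F2],
   [S T S = S] and [T S T = T]. For [v] in the kernel of [T], a contraction
   solves [S (f (xhat + t v + c t)) = 0] with [c] Lipschitz and [c t = o(t)].
   Along the curve [x t = xhat + t v + c t] the values of [f] stay in [F2].
   The rank condition makes [S] bounded below on the range of ['d f (x t)], and
   [S f] vanishes along the curve, so [t |-> f (x t)] has zero derivative
   although [c] itself need not be known to be differentiable. Hence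
   [f (x t) = 0], so maximality of [J xhat] forces ['d J xhat] to vanish on the
   kernel of [T], and [lambda = 'd J xhat \o S] is a multiplier. *)

(** * Mean value inequality and contraction arguments *)

(** Continuous induction: the supremum of the points where the bound with slope [M + e] holds
    belongs to that set and cannot lie below [b]. A local growth condition replaces the derivative,
    so the lemma also covers curves not known to be differentiable. *)
Lemma mean_value_inequality (R : realType) (V : normedModType R)
    (phi : R -> V) (M a b : R) : a <= b ->
  (forall t, a <= t <= b -> forall e, 0 < e -> exists2 d, 0 < d &
    forall s, a <= s <= b -> `|s - t| < d ->
      `|phi s - phi t| <= (M + e) * `|s - t|) ->
  `|phi b - phi a| <= M * (b - a).
Proof.
move=> ab loc; have [->|/eqP anb] := eqVneq a b; first by rewrite !subrr normr0 mulr0.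
have ab' : 0 < b - a by rewrite subr_gt0 lt_neqAle ab; move/eqP: anb => ->.
apply/ler_addgt0Pr => e' e'0; set e := e' / (b - a).
have e0 : 0 < e by rewrite divr_gt0.
rewrite (_ : M * (b - a) + e' = (M + e) * (b - a)); last first.
  by rewrite mulrDl /e divfK// gt_eqF.
set K := M + e.
pose S := [set t | a <= t <= b /\ `|phi t - phi a| <= K * (t - a)].
have Sa : S a by rewrite /S /= lexx ab !subrr normr0 mulr0.
have supS : has_sup S by split; [exists a|exists b => t [/andP[]]].
pose c := sup S.
have ac : a <= c by apply: sup_upper_bound.
have cb : c <= b by apply: ge_sup; [exists a|move=> t [/andP[]]].
have acb : a <= c <= b by rewrite ac.
have [d d0 Hd] := loc c acb e e0; rewrite -/K in Hd.
have Sc : S c.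
  split=> //; have [t St] := sup_adherent d0 supS; rewrite -/c => ct.
  have tc : t <= c by apply: sup_upper_bound.
  have [tab Ht] := St; have := Hd t tab; rewrite ler0_norm ?subr_le0// => /(_ _).
  rewrite distrC opprB => /(_ ltac:(lra)) H.
  have -> : phi c - phi a = (phi c - phi t) + (phi t - phi a) by rewrite addrA subrK.
  apply: (le_trans (ler_normD _ _)); apply: (le_trans (lerD H Ht)); lra.
have [bc|cb'] := leP b c; first by have -> : b = c by [lra]; exact: Sc.2.
pose s := Num.min b (c + d / 2).
have cs : c < s by rewrite lt_min cb' ltrDl divr_gt0.
have sb : s <= b by rewrite ge_min lexx.
have sd : s <= c + d / 2 by rewrite ge_min lexx orbT.
have sab : a <= s <= b by rewrite sb (le_trans ac (ltW cs)).
have Ss : S s.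
  split=> //; have := Hd s sab; rewrite gtr0_norm ?subr_gt0// => /(_ ltac:(lra)) H.
  have -> : phi s - phi a = (phi s - phi c) + (phi c - phi a) by rewrite addrA subrK.
  apply: (le_trans (ler_normD _ _)); apply: (le_trans (lerD H Sc.2)); lra.
have : s <= c by apply: sup_upper_bound.
by rewrite leNgt cs.
Qed.

(** With factor 1/2, the ball of radius twice the norm of [g 0] is mapped into itself, since half
    the radius plus the norm of [g 0] is again the radius. Banach's theorem then applies on this
    ball. *)
Lemma half_contraction_fixpoint (R : realType) (X : completeNormedModType R)
    (g : X -> X) :
  (forall z z', `|z| <= 2 * `|g 0| -> `|z'| <= 2 * `|g 0| ->
    `|g z - g z'| <= 2^-1 * `|z - z'|) ->
  exists2 z, `|z| <= 2 * `|g 0| & g z = z.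
Proof.
move=> gL; pose U := [set z : X | `|z| <= 2 * `|g 0|].
have U0 : U 0 by rewrite /U /= normr0 mulr_ge0.
have gU : {homo g : z / U z >-> U z}.
  move=> z Uz; rewrite /U /= -[g z](subrK (g 0)).
  apply: (le_trans (ler_normD _ _)).
  have := gL z 0 Uz U0; rewrite subr0 => H; move: Uz; rewrite /U /=; lra.
have clU : closed U.
  rewrite (_ : U = (fun z : X => `|z|) @^-1` [set x | x <= 2 * `|g 0|])//.
  by apply: closed_comp; [move=> x _; exact: norm_continuous|exact: closed_le].
have h0 : 0 <= 2^-1 :> R by [].
have [||z Uz zE] := @banach_fixed_point R X U (mkfun gU) _ clU.
- exists (NngNum h0); split=> /=; first lra.
  by move=> [z z'] [/= Uz Uz']; exact: gL.
- by exists 0.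
- by exists z.
Qed.

(* A Newton step with frozen derivative [T]: the fixed points of
   [z |-> S (T z - F z)] lie in the range of [S], where [S \o T] is the
   identity, so that they satisfy [S (F z) = 0]. *)
Lemma approximate_zero (R : realType) (X : completeNormedModType R)
    (Y : normedModType R) (T : {linear X -> Y}) (S : {linear Y -> X})
    (rho : R) (F : X -> Y) :
  0 < rho -> (forall y, `|S y| <= rho * `|y|) ->
  (forall y, S (T (S y)) = S y) ->
  (forall z z', `|z| <= 2 * `|S (F 0)| -> `|z'| <= 2 * `|S (F 0)| ->
    `|F z - F z' - T (z - z')| <= (2 * rho)^-1 * `|z - z'|) ->
  exists e, [/\ `|e| <= 2 * `|S (F 0)|, S (T e) = e & S (F e) = 0].
Proof.
move=> rho0 Sb STS FT.
pose g z := S (T z - F z).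
have g0 : `|g 0| = `|S (F 0)| by rewrite /g linear0 sub0r linearN normrN.
have [z z' zr z'r|e er ge] := @half_contraction_fixpoint R X g.
  rewrite /g -linearB; apply: (le_trans (Sb _)).
  have -> : T z - F z - (T z' - F z') = - (F z - F z' - T (z - z')).
    rewrite !opprB (linearB T) /= addrACA [RHS]addrACA. by congr (_ + _); rewrite addrC.
  rewrite normrN.
  (* The bound [rho] on [S] times the factor [(2 * rho)^-1] gives the contraction factor 1/2. *)
  rewrite mulrC -ler_pdivlMr//; apply: le_trans (FT _ _ _ _) _.
  - by rewrite -g0.
  - by rewrite -g0.
  - by rewrite invfM mulrAC.
have STe : S (T e) = e by rewrite -ge {1}/g STS.
exists e; split=> //; first by rewrite -g0.
by move: ge; rewrite /g linearB STe => /eqP; rewrite subr_eq addrC -subr_eq subrr => /eqP <-.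
Qed.

(** * Estimates from differentiability and class C1 *)

Lemma differentiable_bound (R : realType) (V W : normedModType R)
    (f : V -> W) (x : V) : differentiable f x ->
  forall e, 0 < e -> exists2 d, 0 < d &
    forall h, `|h| < d -> `|f (x + h) - f x - 'd f x h| <= e * `|h|.
Proof.
move=> df e e0; have /eqaddoP/(_ _ e0) := diff_locally df.
move=> /nbhs_ballP[d /= d0 H]; exists d => // h hd.
have := H h; rewrite -ball_normE /= sub0r normrN => /(_ hd).
by rewrite [in X in X -> _]/= !fctE opprD addrA [h + x]addrC.
Qed.

Lemma class_C1_on_nbhs (R : realType) (V W : normedModType R)
    (f : V -> W) (U : set V) (x : V) : class_C1_on f U -> U x ->
  forall e, 0 < e -> \forall z \near x,
    differentiable f z /\ forall h, `|'d f z h - 'd f x h| <= e * `|h|.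
Proof.
move=> [oU dU cU] Ux e e0; near=> z.
have Uz : U z by near: z; exact: open_nbhs_nbhs.
split; first exact: dU.
have opz : `|opnorm ('d f z \- 'd f x)| < e.
  by near: z; move/cvgr0Pnorm_lt : (cU _ Ux); exact.
have [k k0 Hk] := linear_lipschitz (diff_continuous (dU _ Ux)).
have [k' k'0 Hk'] := linear_lipschitz (diff_continuous (dU _ Uz)).
(* The bound [k' + k] makes the set of norms bounded, so that [opnorm] is here a true supremum and
   not the default value 0. *)
have B h : `|h| <= 1 -> `|'d f z h - 'd f x h| <= e.
  move=> h1; apply: le_trans (ltW opz); apply: le_trans (ler_norm _).
  apply: sup_upper_bound; last by exists h.
  split; first by exists `|('d f z \- 'd f x) h|; exists h.
  exists (k' + k) => _ [u /= u1 <-]; apply: (le_trans (ler_normB _ _)).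
  apply: lerD.
    by apply: (le_trans (Hk' _)); rewrite ler_piMr// ltW.
  by apply: (le_trans (Hk _)); rewrite ler_piMr// ltW.
move=> h; have [->|h0] := eqVneq h 0.
  by rewrite !raddf0 addr0 !normr0 mulr0.
have nh : 0 < `|h| by rewrite normr_gt0.
have := B (`|h|^-1 *: h); rewrite normrZ normfV normr_id mulVf ?gt_eqF// => /(_ (lexx _)).
rewrite !linearZZ -scalerDr normrZ normfV normr_id mulrC.
by rewrite ler_pdivrMr.
Unshelve. all: by end_near. Qed.

(** The mean value inequality is applied on [0, 1] to [phi], the restriction of [f - T] to the
    segment from [z] to [y], up to a constant; the segment stays in the ball by convexity. *)
Lemma mean_value_differential (R : realType) (V W : normedModType R)
    (f : V -> W) (T : {linear V -> W}) (x : V) (r e : R) :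
  (forall z, `|z - x| < r ->
    differentiable f z /\ forall h, `|'d f z h - T h| <= e * `|h|) ->
  forall y z, `|y - x| < r -> `|z - x| < r ->
    `|f y - f z - T (y - z)| <= e * `|y - z|.
Proof.
move=> H y z yr zr; pose u := y - z.
pose phi (t : R) := f (z + t *: u) - t *: T u.
have phi1 : phi 1 = f y - T u.
  by rewrite /phi !scale1r (_ : z + u = y)// addrC subrK.
have phi0 : phi 0 = f z by rewrite /phi !scale0r addr0 subr0.
suff : `|phi 1 - phi 0| <= (e * `|u|) * (1 - 0).
  by rewrite phi1 phi0 subr0 mulr1 addrAC.
apply: mean_value_inequality => // t /andP[t0 t1] eta eta0.
pose p := z + t *: u.
have pr : `|p - x| < r.
  have -> : p - x = (1 - t) *: (z - x) + t *: (y - x).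
    have E (a b : V) : (1 - t) *: a + t *: b = a + t *: (b - a).
      by rewrite scalerBl scale1r scalerBr [t *: b - _]addrC addrA.
    rewrite E opprB addrA subrK.
    by rewrite addrAC.
  apply: (le_lt_trans (ler_normD _ _)); rewrite !normrZ (ger0_norm t0) ger0_norm ?subr_ge0//.
  have [m [am bm mr]] : exists m, [/\ `|z - x| <= m, `|y - x| <= m & m < r].
    by exists (Num.max `|z - x| `|y - x|); rewrite !le_max !lexx orbT gt_max zr yr.
  by apply: le_lt_trans mr; nra.
have [dp bp] := H p pr.
(* Adding 1 keeps the divisor positive when [u] is zero. *)
have u1 : 0 < `|u| + 1 by rewrite ltr_wpDl.
have [d d0 Hd] := differentiable_bound dp (divr_gt0 eta0 u1).
exists (d / (`|u| + 1)); first by rewrite divr_gt0.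
move=> s _ sd; pose h := (s - t) *: u.
have hd : `|h| < d.
  rewrite normrZ; move: sd; rewrite ltr_pdivlMr// => /(le_lt_trans _); apply.
  by rewrite ler_wpM2l// lerDl.
have -> : phi s - phi t = (f (p + h) - f p - 'd f p h) + ('d f p h - T h).
  have -> : p + h = z + s *: u.
    by rewrite /p /h -addrA -scalerDl [t + _]addrC subrK.
  have -> : T h = s *: T u - t *: T u by rewrite /h scalerBl linearB !linearZZ.
  rewrite subrKA /phi !opprB [t *: T u - f _]addrC addrACA; congr (_ + _).
  by rewrite addrC.
apply: (le_trans (ler_normD _ _)); apply: (le_trans (lerD (Hd _ hd) (bp h))).
rewrite /h normrZ; have : eta / (`|u| + 1) * `|u| <= eta.
  by rewrite mulrAC ler_pdivrMr// ler_pM2l// lerDl.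
move: (eta / _) => k ku; have := normr_ge0 (s - t); nra.
Qed.

(** * Projections, open mapping and the pseudo-inverse *)

Definition linear_pack (R : realType) (V W : normedModType R) (f : V -> W)
    (lf : linear f) : {linear V -> W} :=
  HB.pack f (GRing.isLinear.Build _ _ _ _ _ lf).

(** [P] is the first component of the continuous inverse of addition; its linearity comes from
    uniqueness of the decomposition. *)
Lemma direct_sum_projection (R : realType) (V : normedModType R) (E F : set V) :
  topological_direct_sum E F ->
  exists P : {linear V -> V}, [/\ continuous P, forall v, E (P v),
    forall v, F (v - P v), forall v, E v -> P v = v &
    forall v, F v -> P v = 0].
Proof.
move=> [[[E0 Elin] _] [[F0 Flin] _] _ [g [gEF gadd addg gC]]].
have ElinP a u v : E u -> E v -> E (a *: u + v).
  by move=> /mem_set Eu /mem_set Ev; apply: set_mem; apply: Elin.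
have FlinP a u v : F u -> F v -> F (a *: u + v).
  by move=> /mem_set Fu /mem_set Fv; apply: set_mem; apply: Flin.
have E0P : E 0 by apply: set_mem; exact: E0.
have F0P : F 0 by apply: set_mem; exact: F0.
have lin : linear (fun v => (g v).1).
  move=> a u v; pose p := (a *: (g u).1 + (g v).1, a *: (g u).2 + (g v).2).
  have -> : a *: u + v = p.1 + p.2.
    rewrite /p /= addrACA -scalerDr.
    by have /= -> := addg u; have /= -> := addg v.
  rewrite gadd//; split=> /=.
    by apply: ElinP; [exact: (gEF u).1|exact: (gEF v).1].
  by apply: FlinP; [exact: (gEF u).2|exact: (gEF v).2].
exists (linear_pack lin); split=> /=.
- move=> v; apply: (@continuous_comp _ _ _ g fst); first exact: gC.
  exact: cvg_fst.
- by move=> v; exact: (gEF v).1.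
- move=> v; rewrite -[in X in X - _](addg v) addrC addKr.
  exact: (gEF v).2.
- by move=> v Ev; have /= := gadd (v, 0) (conj Ev F0P); rewrite addr0 => ->.
- by move=> v Fv; have /= := gadd (0, v) (conj E0P Fv); rewrite add0r => ->.
Qed.

Section open_mapping.
Variables (R : realType) (X Y : completeNormedModType R).
Variables (T : {linear X -> Y}) (P : {linear Y -> Y}).
Hypotheses (Tc : continuous T) (Pc : continuous P).
Hypotheses (PT : forall x, P (T x) = T x).
Hypotheses (TP : forall y, exists x, T x = P y).

(* Since [P] maps onto the range of [T], pulling the closures of the images of
   balls back along [P] lets Baire's theorem be applied in [Y] itself. *)
Lemma approximate_preimage :
  exists2 K : R, 0 < K & forall y e, 0 < e ->
    exists2 x, `|x| <= K * `|y| & `|P y - T x| < e.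
Proof.
have [k k0 Pk] := linear_lipschitz Pc.
(* [B n] is the preimage under [P] of the closure of the image under [T] of the ball of radius [n].
   These sets cover [Y], so by Baire one of them contains a ball. *)
pose B (n : nat) := [set y | forall e, 0 < e ->
  exists2 x, `|x| <= n%:R & `|P y - T x| < e].
have oB n : open (~` B n).
  rewrite openE => y /= /existsNP[e /not_implyP[e0 Hx]].
  have Hx' x : `|x| <= n%:R -> e <= `|P y - T x|.
    by move=> xn; rewrite leNgt; apply/negP => xe; apply: Hx; exists x.
  apply/nbhs_ballP; exists (e / 2 / k) => /=; first by rewrite !divr_gt0.
  move=> z; rewrite -ball_normE /= ltr_pdivlMr// => yz.
  move=> /(_ (e / 2) (divr_gt0 e0 _))[//|x xn zx].
  have := Hx' x xn; apply/negP; rewrite -ltNge.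
  rewrite -(subrKA (P z)); apply: (le_lt_trans (ler_normD _ _)).
  rewrite -linearB; have := Pk (y - z); lra.
have [n nd] : exists n, ~ dense (~` B n).
  apply/existsNP => dB.
  have /(_ setT) : dense (\bigcap_n ~` B n) by exact: Baire.
  case; [by exists 0|exact: openT|move=> y [_ By]].
  have [x xy] := TP y; have := By (Num.truncn `|x|).+1 I.
  by apply => e e0; exists x; [exact/ltW/truncnS_gt|rewrite xy subrr normr0].
have [y0 [r r0 rB]] : exists y0, exists2 r, 0 < r & forall y, `|y| < r -> B n (y0 + y).
  move: nd => /existsNP[D /not_implyP[[y0 Dy0] /not_implyP[oD DB]]].
  have /nbhs_ballP[r /= r0 Hr] : nbhs y0 D by exact: open_nbhs_nbhs.
  exists y0; exists r => // y yr.
  apply: contrapT => nB; apply: DB; exists (y0 + y); split=> //.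
  by apply: Hr; rewrite -ball_normE /= opprD addNKr normrN.
exists ((4 * n%:R + 1) / r); first by rewrite divr_gt0// ltr_wpDl.
move=> y e e0; have [->|yn0] := eqVneq y 0.
  by exists 0; rewrite ?raddf0 ?addr0 ?normr0 ?mulr0//.
have ny : 0 < `|y| by rewrite normr_gt0.
(* [c *: y] has norm [r / 2]. Subtracting the approximations at [y0 + c *: y] and at [y0] gives one
   for [P (c *: y)] by a vector of norm at most [2 * n%:R]; dividing by [c] yields the constant
   [4 * n%:R / r], and the added 1 only ensures positivity. *)
pose c := r / (2 * `|y|).
have c0 : 0 < c by rewrite divr_gt0// mulr_gt0.
have cy : `|c *: y| < r.
  rewrite normrZ gtr0_norm// (_ : c * _ = r / 2); first lra.
  by rewrite /c; field; rewrite gt_eqF.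
have ec : 0 < c * e / 2 by rewrite divr_gt0// mulr_gt0.
have [x1 x1n H1] := rB _ cy _ ec.
have [] := rB 0 _ _ ec; first by rewrite normr0.
move=> x2 x2n; rewrite addr0 => H2.
exists (c^-1 *: (x1 - x2)).
  rewrite normrZ normfV gtr0_norm// /c invf_div.
  have : `|x1 - x2| <= n%:R + n%:R by apply: (le_trans (ler_normB _ _)); exact: lerD.
  move=> H; rewrite mulrAC [leRHS]mulrAC ler_pM2r ?invr_gt0//.
  by have := normr_ge0 (x1 - x2); nra.
rewrite -(@ltr_pM2l _ c)// -{1}(gtr0_norm c0) -normrZ scalerBr -linearZZ.
rewrite -[c *: T _]linearZZ scalerA divff ?gt_eqF// scale1r.
have -> : P (c *: y) - T (x1 - x2) = (P (y0 + c *: y) - T x1) - (P y0 - T x2).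
  rewrite (linearB T) (linearD P) !opprB [RHS]addrC -[P y0 + _ - _]addrA.
  by rewrite [RHS]addrA subrK addrCA.
apply: (le_lt_trans (ler_normB _ _)); lra.
Qed.

(** Successive approximation: each correction halves the residual, so the corrections are dominated
    by a geometric series of sum [2 * K] times the norm of [y] and add up to an exact preimage by
    completeness of [X]. *)
Lemma bounded_preimage :
  exists2 K : R, 0 < K & forall y, exists2 x, `|x| <= K * `|y| & T x = P y.
Proof.
have [K K0 HK] := approximate_preimage.
have [k k0 Pk] := linear_lipschitz Pc.
have PP y : P (P y) = P y by have [x <-] := TP y; rewrite PT.
have /choice[G GP] : forall y, exists x,
    `|x| <= K * `|y| /\ `|P y - T x| <= 2^-1 * `|y|.
  move=> y; have [->|yn0] := eqVneq y 0.
    by exists 0; rewrite ?raddf0 ?addr0 ?normr0 ?mulr0//.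
  have [|x xy /ltW xy'] := HK y (2^-1 * `|y|).
    by rewrite mulr_gt0// normr_gt0.
  by exists x.
exists (2 * K); first by rewrite mulr_gt0.
move=> y.
pose u n := iter n (fun z => P z - T (G z)) y.
have un n : `|u n| <= 2^-1 ^+ n * `|y|.
  elim: n => [|n IH]; first by rewrite expr0 mul1r.
  rewrite exprS -mulrA; apply: le_trans (GP (u n)).2 _.
  by rewrite ler_pM2l.
pose x n := G (u n).
have xn n : `|x n| <= geometric (K * `|y|) 2^-1 n.
  rewrite /= -mulrA [`|y| * _]mulrC.
  by apply: le_trans (GP _).1 _; rewrite ler_pM2l.
have half : `|2^-1 : R| < 1 by rewrite ger0_norm//; lra.
have cx : cvgn (series x).
  apply: normed_cvg; apply: (series_le_cvg _ _ xn) => [n|n|].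
  - exact: normr_ge0.
  - by apply: le_trans (xn n).
  - exact: is_cvg_geometric_series.
(* The sum telescopes because [P] is idempotent and fixes the range of [T]. *)
have Tx n : T (series x n) = P y - P (u n).
  elim: n => [|n IH]; first by rewrite /series /= big_geq// linear0 subrr.
  rewrite seriesSr linearD IH /x /= (linearB P) PP PT opprB -addrA.
  by congr (_ + _); rewrite addrC.
exists (limn (series x)).
  have clB : closed [set z : X | `|z| <= 2 * K * `|y|].
    rewrite (_ : mkset _ = (fun z : X => `|z|) @^-1` [set t | t <= 2 * K * `|y|])//.
    by apply: closed_comp; [move=> z _; exact: norm_continuous|exact: closed_le].
  apply: (closed_cvg _ clB _ _ cx); apply: nearW => n /=.
  apply: (@le_trans _ _ (series (geometric (K * `|y|) 2^-1) n)).
    rewrite /series /=; apply: le_trans (ler_norm_sum _ _ _) _.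
    by apply: ler_sum => i _; exact: xn.
  rewrite geometric_seriesE /=; last by rewrite lt_eqF//; lra.
  have h : 0 <= 2^-1 ^+ n :> R by rewrite exprn_ge0.
  have hy : 0 <= K * `|y| by rewrite mulr_ge0// ltW.
  rewrite ler_pdivrMr; last lra.
  by move: (2^-1 ^+ n) h => q h; nra.
have c1 : T (series x n) @[n --> \oo] --> T (limn (series x)).
  by apply: (@cvg_comp _ _ _ (series x) T _ _ _ cx); exact: Tc.
have u0 : u n @[n --> \oo] --> (0 : Y).
  apply/cvgr0Pnorm_lt => e e0.
  have := @cvg_geometric R `|y| 2^-1 half.
  move=> /cvgr0Pnorm_lt /(_ e e0); apply: filterS => n /=.
  apply: le_lt_trans; apply: le_trans (un n) _.
  by rewrite mulrC; exact: ler_norm.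
have c2 : T (series x n) @[n --> \oo] --> P y - P 0.
  rewrite (_ : (fun n => _) = (fun n => P y - P (u n))); last first.
    by apply/funext => n; exact: Tx.
  apply: cvgB; first exact: cvg_cst.
  by apply: (@cvg_comp _ _ _ u P _ _ _ u0); exact: Pc.
rewrite -[RHS]subr0 -(linear0 P).
exact: (cvg_unique _ c1 c2).
Qed.

End open_mapping.

(** [S] sends [y] to the [E1] component of any bounded preimage of its projection [PY y] on the
    range of [T]. *)
Lemma bounded_pseudo_inverse (R : realType) (X Y : completeNormedModType R)
    (T : {linear X -> Y}) (E1 : set X) (F2 : set Y) :
  continuous T ->
  topological_direct_sum E1 [set h | T h = 0] ->
  topological_direct_sum (range T) F2 ->
  exists S : {linear Y -> X}, exists2 rho : R, 0 < rho &
    [/\ forall y, `|S y| <= rho * `|y|, forall y, S (T (S y)) = S y,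
        forall h, T (S (T h)) = T h & forall y, S y = 0 -> F2 y].
Proof.
move=> Tc /direct_sum_projection[PX [PXc PXE PXk PXid PX0]].
move=> /direct_sum_projection[PY [PYc PYr PYF PYid _]].
have PYT x : PY (T x) = T x by apply: PYid; exists x.
have TPY y : exists x, T x = PY y by have [x _ <-] := PYr y; exists x.
have [K K0 HK] := bounded_preimage Tc PYc PYT TPY.
have /choice[H HH] : forall y, exists x, `|x| <= K * `|y| /\ T x = PY y.
  by move=> y; have [x] := HK y; exists x.
have [k k0 PXb] := linear_lipschitz PXc.
(* Two preimages of one point differ by a kernel vector, which [PX] kills. Hence the arbitrary
   choice [H] becomes linear after composition with [PX]. *)
have HE y x : T x = PY y -> PX (H y) = PX x.
  move=> Tx; apply/eqP; rewrite -subr_eq0 -linearB; apply/eqP/PX0 => /=.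
  by rewrite linearB (HH y).2 Tx subrr.
have TPX x : T (PX x) = T x.
  by apply/eqP; rewrite eq_sym -subr_eq0 -linearB; apply/eqP/PXk.
have lin : linear (fun y => PX (H y)).
  move=> a u v; rewrite -linearP; apply: HE.
  by rewrite !linearP (HH u).2 (HH v).2.
exists (linear_pack lin); exists (k * K); first by rewrite mulr_gt0.
split=> /= [y|y|h|y].
- by apply: le_trans (PXb _) _; rewrite -mulrA ler_pM2l// (HH y).1.
- by rewrite (HE _ (PX (H y)))// PXid.
- by rewrite TPX (HH _).2.
- move=> /(congr1 T); rewrite TPX (HH y).2 linear0 => y0.
  by have := PYF y; rewrite y0 subr0.
Qed.

(** * A curve in the zero set of [f] with prescribed tangent *)

Section level_curve.
Variables (R : realType) (X : completeNormedModType R) (Y : normedModType R).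
Variables (f : X -> Y) (x0 v : X) (S : {linear Y -> X}) (rho r : R).
Hypotheses (rho0 : 0 < rho) (r0 : 0 < r).
Hypothesis Sb : forall y, `|S y| <= rho * `|y|.
Hypothesis STS : forall y, S ('d f x0 (S y)) = S y.
Hypothesis df : forall z, `|z - x0| < r ->
  differentiable f z /\ forall h, `|'d f z h - 'd f x0 h| <= (2 * rho)^-1 * `|h|.
Hypothesis rank : forall z, `|z - x0| < r ->
  forall h, S ('d f z h) = 0 -> 'd f z h = 0.
Hypotheses (fx0 : f x0 = 0) (v0 : 'd f x0 v = 0).

(* [approximate_zero] for the affine map [e |-> 'd f z e - 'd f z w] produces
   [e] with ['d f z e = 'd f z w] and [`|e| <= 2 * `|S ('d f z w)|]. *)
Lemma differential_bound z : `|z - x0| < r -> exists2 k, 0 < k &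
  forall w, `|'d f z w| <= k * `|S ('d f z w)|.
Proof.
move=> zr; have [dz Hz] := df zr.
have [k k0 Hk] := linear_lipschitz (diff_continuous dz).
exists (k * 2) => [|w]; first by rewrite mulr_gt0.
pose F e := 'd f z e - 'd f z w.
have F0 : `|S (F 0)| = `|S ('d f z w)|.
  by rewrite /F (linear0 ('d f z)) sub0r linearN normrN.
have [e e' _ _|e [eb _ Se]] := @approximate_zero R X Y ('d f x0) S rho F rho0 Sb STS.
  rewrite /F opprB addrA subrK.
  by rewrite -(linearB ('d f z)); exact: Hz.
have : 'd f z (w - e) = 0.
  apply: rank => //; move: Se; rewrite /F -(linearB ('d f z)) => Se.
  by rewrite -opprB !linearN Se oppr0.
rewrite (linearB ('d f z)) => /eqP; rewrite subr_eq0 => /eqP ->.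
apply: le_trans (Hk e) _; rewrite -mulrA ler_pM2l//.
move: eb; rewrite F0 => /le_trans; apply.
by rewrite ler_pM2l// /F in Se *; move: Se; rewrite linearB => /eqP; rewrite subr_eq0 => /eqP ->.
Qed.

(** The smallness for every [eta] says that the correction is o(t): the zero set is approached from
    [x0] in the direction [v]. *)
Lemma level_curve eta : 0 < eta -> exists2 d, 0 < d &
  forall t, 0 <= t <= d ->
    exists2 e, `|e| <= eta * t & f (x0 + t *: v + e) = 0.
Proof.
move=> eta0; have mv := mean_value_differential df.
set eps := (2 * rho)^-1 in mv.
have rhoeps : rho * eps = 2^-1 by rewrite /eps; field; rewrite gt_eqF.
have [n n0 vn] : exists2 n, 0 < n & `|v| <= n.
  by exists (`|v| + 1); rewrite ?lerDl// ltr_wpDl.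
(* The factor 3 leaves room for [t *: v] plus a correction of at most the same norm, with strict
   inequality. *)
have [a a0 an] : exists2 a, 0 < a & forall t, t <= a -> 3 * (t * n) <= r.
  exists (r / (3 * n)) => [|t]; first by rewrite divr_gt0// mulr_gt0.
  by rewrite ler_pdivlMr ?mulr_gt0// mulrCA.
have inball t z : 0 <= t <= a -> `|z| <= t * `|v| -> `|x0 + t *: v + z - x0| < r.
  move=> /andP[t0 ta] zt; rewrite -[_ + z]addrA [x0 + _]addrC addrK.
  apply: (le_lt_trans (ler_normD _ _)); rewrite normrZ ger0_norm//.
  have := r0; have := an t ta; have := ler_wpM2l t0 vn; lra.
have x0r : `|x0 - x0| < r by rewrite subrr normr0.
(* As [v] is in the kernel, the mean value estimate bounds [f (x0 + t *: v)] by [eps] times the norm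
   of [t *: v]. With [rho * eps] equal to 1/2, the ball in which the correction is sought has a
   radius covered by [inball]. *)
have Sp t : 0 <= t <= a -> 2 * `|S (f (x0 + t *: v))| <= t * `|v|.
  move=> ta; have := mv (x0 + t *: v) x0 _ x0r.
  have := inball t 0 ta; rewrite normr0 addr0 mulr_ge0//; last by case/andP: ta.
  move=> /(_ isT) H /(_ H); rewrite fx0 subr0 [x0 + _]addrC addrK linearZZ v0 scaler0 subr0.
  rewrite normrZ ger0_norm; last by case/andP: ta.
  move=> Hf; have := ler_wpM2l (ltW rho0) Hf; rewrite mulrA rhoeps.
  by have := Sb (f (t *: v + x0)); lra.
have /choice[c cP] : forall t, exists e, 0 <= t <= a ->
    [/\ `|e| <= 2 * `|S (f (x0 + t *: v))|, S ('d f x0 e) = e &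
        S (f (x0 + t *: v + e)) = 0].
  move=> t; have [ta|] := boolP (0 <= t <= a); last by exists 0.
  have [z z' zb z'b|e He] := @approximate_zero R X Y ('d f x0) S rho
      (fun z => f (x0 + t *: v + z)) rho0 Sb STS.
    rewrite addr0 in zb z'b.
    have -> : z - z' = (x0 + t *: v + z) - (x0 + t *: v + z').
      by rewrite opprD addrACA subrr add0r.
    by apply: mv; apply: inball => //; apply: le_trans (Sp t ta).
  by exists e => _; move: He; rewrite addr0.
pose x t := x0 + t *: v + c t.
have xr t : 0 <= t <= a -> `|x t - x0| < r.
  move=> ta; apply: inball => //; have [ct _ _] := cP t ta.
  exact: le_trans ct (Sp t ta).
have xE s t : x s - x t = (s - t) *: v + (c s - c t).
  by rewrite /x opprD addrACA; congr (_ + _); rewrite opprD addrACA subrr add0r scalerBl.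
(* [S] composed with the differential at [x0] fixes [c s - c t], and [S] kills [f] along the curve.
   So [c s - c t] has at most half the norm of [x s - x t], which is absorbed on the left. *)
have lip s t : 0 <= s <= a -> 0 <= t <= a -> `|x s - x t| <= 2 * n * `|s - t|.
  move=> sa ta; have [_ Scs fs] := cP s sa; have [_ Sct ft] := cP t ta.
  have E : S (f (x s) - f (x t) - 'd f x0 (x s - x t)) = - (c s - c t).
    have -> : 'd f x0 (x s - x t) = 'd f x0 (c s - c t).
      by rewrite xE linearD linearZZ v0 scaler0 add0r.
    rewrite (linearB S) (linearB S) fs ft subrr sub0r (linearB ('d f x0)).
    by rewrite (linearB S) Scs Sct.
  have : `|c s - c t| <= 2^-1 * `|x s - x t|.
    rewrite -normrN -E; apply: le_trans (Sb _) _; rewrite -rhoeps -mulrA ler_pM2l//.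
    by apply: mv; exact: xr.
  have := ler_normD ((s - t) *: v) (c s - c t); rewrite -xE normrZ.
  have := ler_wpM2l (normr_ge0 (s - t)) vn; lra.
have f0 t : 0 <= t <= a -> f (x t) = 0.
  move=> ta; have /andP[t0 t1] := ta.
  have c0 : c 0 = 0.
    have [|+ _ _] := cP 0; first by rewrite lexx ltW.
    by rewrite scale0r addr0 fx0 linear0 normr0 mulr0 normr_le0 => /eqP.
  have : `|f (x t) - f (x 0)| <= 0 * (t - 0).
    apply: (@mean_value_inequality R Y (f \o x)) => // s /andP[s0 st] e e0.
    have sa : 0 <= s <= a by rewrite s0 (le_trans st).
    have [k k0 Hk] := differential_bound (xr s sa).
    have kr : 0 < 1 + k * rho by rewrite ltr_wpDr// mulr_ge0// ltW.
    (* The increment of [f] is the remainder [q] plus the differential term [D]. Since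
       [S D = - S q], [differential_bound] controls [D] by [k * rho] times the norm of [q]; the
       Lipschitz constant [2 * n] turns the total into [e] times the step. The dependence of [k] on
       [s] is harmless because the growth condition is local. *)
    have e'0 : 0 < e / (2 * n * (1 + k * rho)) by rewrite divr_gt0// !mulr_gt0.
    have [d d0 Hd] := differentiable_bound (df (xr s sa)).1 e'0.
    exists (d / (2 * n)) => [|u /andP[u0 ut] us]; first by rewrite divr_gt0// mulr_gt0.
    have ua : 0 <= u <= a by rewrite u0 (le_trans ut).
    pose w := x u - x s.
    have wl : `|w| <= 2 * n * `|u - s| by exact: lip.
    have wd : `|w| < d.
      by apply: le_lt_trans wl _; rewrite mulrC -ltr_pdivlMr// mulr_gt0.
    have := Hd w wd; rewrite /w [x s + _]addrC subrK -/w.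
    set D := 'd f (x s) w; set q := f (x u) - f (x s) - D => Hq.
    have SD : `|S D| <= rho * `|q|.
      have -> : S D = - S q.
        have [_ _ fs] := cP s sa; have [_ _ fu] := cP u ua.
        by rewrite /q !linearB /= fs fu subrr sub0r opprK.
      by rewrite normrN; exact: Sb.
    have -> : (f \o x) u - (f \o x) s = q + D by rewrite /q subrK.
    apply: le_trans (ler_normD _ _) _.
    have : `|q| + `|D| <= (1 + k * rho) * `|q|.
      rewrite mulrDl mul1r lerD2l -mulrA; apply: le_trans (Hk w) _.
      by rewrite ler_pM2l.
    move=> /le_trans; apply; rewrite add0r.
    apply: (@le_trans _ _ ((1 + k * rho) * (e / (2 * n * (1 + k * rho)) * (2 * n * `|u - s|)))).
      rewrite ler_pM2l//; apply: le_trans Hq _; rewrite ler_pM2l//.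
    by rewrite le_eqVlt; apply/orP; left; apply/eqP; field; rewrite !gt_eqF.
  rewrite mul0r normr_le0 subr_eq0 => /eqP ->.
  by rewrite /x c0 scale0r !addr0.
(* This precision is chosen so that [2 * rho * n] times it is [eta], as needed in the bound of [c t]
   by twice the norm of [S (f (x0 + t *: v))]. *)
have e'0 : 0 < eta / (2 * rho * n) by rewrite divr_gt0// !mulr_gt0.
have [d d0 Hd] := differentiable_bound (df x0r).1 e'0.
exists (Num.min a (d / (2 * n))).
  by rewrite lt_min a0 divr_gt0// mulr_gt0.
move=> t /andP[t0]; rewrite le_min => /andP[ta td].
have t0a : 0 <= t <= a by rewrite t0.
exists (c t); last exact: f0.
have [ct _ _] := cP t t0a; apply: le_trans ct _.
have tv : `|t *: v| <= t * n by rewrite normrZ ger0_norm// ler_wpM2l.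
have tvd : `|t *: v| < d.
  apply: le_lt_trans tv _; move: td; rewrite ler_pdivlMr ?mulr_gt0//; nra.
have := Hd _ tvd; rewrite fx0 linearZZ v0 scaler0 !subr0 => H.
apply: (@le_trans _ _ (2 * (rho * (eta / (2 * rho * n) * (t * n))))).
  rewrite ler_pM2l//; apply: le_trans (Sb _) _; rewrite ler_pM2l//.
  by apply: le_trans H _; rewrite ler_pM2l.
by rewrite le_eqVlt; apply/orP; left; apply/eqP; field; rewrite !gt_eqF.
Qed.

End level_curve.

(** * First-order optimality and the multiplier *)

(** If the derivative along [v] were positive, the first-order gain at a point of [Z] near
    [x0 + t *: v] would exceed all errors. Only an inequality results, since [t] is nonnegative. *)
Lemma local_max_differential_le0 (R : realType) (X : normedModType R)
    (J : X -> R) (x0 v : X) (r : R) (Z : set X) :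
  differentiable J x0 -> 0 < r ->
  (forall x, `|x - x0| < r -> Z x -> J x <= J x0) ->
  (forall eta, 0 < eta -> exists2 d, 0 < d &
    forall t, 0 <= t <= d -> exists2 e, `|e| <= eta * t & Z (x0 + t *: v + e)) ->
  'd J x0 v <= 0.
Proof.
move=> dJ r0 Jmax curve; rewrite leNgt; apply/negP => Jv.
have [k k0 Hk] := linear_lipschitz (diff_continuous dJ).
(* [n] collects the errors per unit of [eta * t]: [k] from the differential applied to [e], and the
   norm of [v] plus 1 from the Taylor remainder, using [eta <= 1]. *)
pose n := `|v| + 1 + k.
have n1 : `|v| + 1 < n by rewrite ltrDl.
have n0 : 0 < n by rewrite (le_lt_trans _ n1)// addr_ge0.
pose eta := Num.min 1 ('d J x0 v / (2 * n)).
have eta0 : 0 < eta by rewrite lt_min ltr01 divr_gt0// mulr_gt0.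
have eta1 : eta <= 1 by rewrite ge_min lexx.
have etan : eta * n < 'd J x0 v.
  have : eta <= 'd J x0 v / (2 * n) by rewrite ge_min lexx orbT.
  rewrite ler_pdivlMr ?mulr_gt0//.
  by move: (mulr_gt0 eta0 n0); lra.
have [d d0 Hd] := differentiable_bound dJ eta0.
have [d' d'0 Hd'] := curve _ eta0.
pose m := Num.min d r.
have m0 : 0 < m by rewrite lt_min d0.
pose t := Num.min d' (m / (2 * n)).
have t0 : 0 < t by rewrite lt_min d'0 divr_gt0// mulr_gt0.
have tm : 2 * (t * n) <= m.
  have : t <= m / (2 * n) by rewrite ge_min lexx orbT.
  by rewrite ler_pdivlMr ?mulr_gt0// mulrCA.
have [|e eb Ze] := Hd' t; first by rewrite ltW// ge_min lexx.
pose w := t *: v + e.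
have wb : `|w| <= t * (`|v| + 1).
  apply: le_trans (ler_normD _ _) _; rewrite normrZ gtr0_norm//.
  rewrite mulrDr mulr1 lerD2l; apply: le_trans eb _.
  by rewrite ger_pMl.
have wm : `|w| < m.
  have := mulr_gt0 t0 n0; have := ler_wpM2l (ltW t0) (ltW n1); lra.
have := Hd w; rewrite (lt_le_trans wm) ?ge_min ?lexx// => /(_ isT).
have : J (x0 + w) <= J x0.
  apply: Jmax; last by rewrite /w addrA.
  by rewrite addrC addKr (lt_le_trans wm)// ge_min lexx orbT.
move=> Jw /ler_normlP[+ _].
have -> : 'd J x0 w = t * 'd J x0 v + 'd J x0 e by rewrite /w linearD linearZZ.
have := Hk e => /ler_normlP[+ _].
have etat : 0 < eta * t by rewrite mulr_gt0.
have : k * `|e| <= k * (eta * t) by rewrite ler_pM2l.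
have : eta * `|w| <= eta * (t * (`|v| + 1)) by rewrite ler_pM2l.
have : t * (eta * n) < t * 'd J x0 v by rewrite ltr_pM2l.
rewrite /n; lra.
Qed.

Theorem theorem4p1 (R : realType) (X Y : completeNormedModType R)
    (A : set X) (J : X -> R) (f : X -> Y) (xhat : X)
    (E1 : set X) (F2 : set Y) :
  open A ->
  local_solution A J f xhat ->
  differentiable J xhat ->
  (exists U : set X, [/\ U xhat, U `<=` A & class_C1_on f U]) ->
  topological_direct_sum E1 [set h : X | 'd f xhat h = 0] ->
  topological_direct_sum (range ('d f xhat)) F2 ->
  (exists A0 : set X,
    [/\ open A0, A0 xhat, A0 `<=` A,
        forall x, A0 x -> differentiable f x &
        forall x, A0 x -> range ('d f x) `&` F2 = [set 0]]) ->
  exists lambda : {linear Y -> R^o},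
    continuous lambda /\ forall h : X, 'd J xhat h = lambda ('d f xhat h).
Proof.
move=> oA [Axhat fxhat Jmax] dJ [U [Uxhat _ C1]] sumX sumY.
move=> [A0 [oA0 A0xhat _ _ rank]].
have [oU dU _] := C1; have dfx := dU _ Uxhat.
have [S [rho rho0 [Sb STS TST SF2]]] :=
  bounded_pseudo_inverse (diff_continuous dfx) sumX sumY.
have eps0 : 0 < (2 * rho)^-1 by rewrite invr_gt0 mulr_gt0.
have : \forall z \near xhat,
    [/\ differentiable f z /\ forall h, `|'d f z h - 'd f xhat h| <= (2 * rho)^-1 * `|h|,
        A0 z & f z = 0 -> J z <= J xhat].
  near=> z; split; near: z.
  - exact: (class_C1_on_nbhs C1).
  - exact: open_nbhs_nbhs.
  - have An : nbhs xhat A by exact: open_nbhs_nbhs.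
    have Jloc : \forall z \near xhat, A z -> f z = 0 -> J z <= J xhat := Jmax.
    by apply: filterS2 An Jloc => z Az; exact.
move=> /nbhs_ballP[r /= r0 Hr].
have Hr' z : `|z - xhat| < r ->
    [/\ differentiable f z /\ forall h, `|'d f z h - 'd f xhat h| <= (2 * rho)^-1 * `|h|,
        A0 z & f z = 0 -> J z <= J xhat].
  by move=> zr; apply: Hr; rewrite -ball_normE /= distrC.
have Jker v : 'd f xhat v = 0 -> 'd J xhat v <= 0.
  move=> v0; apply: (@local_max_differential_le0 R X J xhat v r [set x | f x = 0]) => //.
    by move=> x /Hr'[].
  apply: (@level_curve R X Y f xhat v S rho r) => //.
    by move=> z /Hr'[].
  (* The kernel of [S] lies in [F2], so the intersection condition at [z] forces the value of the
     differential to vanish. *)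
  move=> z /Hr'[_ A0z _] h /SF2 Fh.
  have : (range ('d f z) `&` F2) ('d f z h) by split=> //; exists h.
  by rewrite rank.
(* The kernel is symmetric, so the inequality at [v] and at [- v] gives equality. *)
have Jker0 v : 'd f xhat v = 0 -> 'd J xhat v = 0.
  move=> v0; apply/eqP; rewrite eq_le Jker//=.
  by rewrite -oppr_le0 -linearN; apply: Jker; rewrite linearN v0 oppr0.
have lin : linear (fun y => 'd J xhat (S y) : R^o).
  by move=> a u v; rewrite !linearP.
have Sc : continuous S.
  apply: bounded_linear_continuous; apply/linear_boundedP.
  exists rho; split=> [|k rhok y]; first exact: num_real.
  by apply: le_trans (Sb y) _; rewrite ler_wpM2r// ltW.
exists (linear_pack lin); split=> [y|h] /=.
  apply: (@continuous_comp _ _ _ S ('d J xhat)); first exact: Sc.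
  exact: (diff_continuous dJ).
(* By [TST], the difference of [h] and [S ('d f xhat h)] lies in the kernel of the differential,
   where ['d J xhat] vanishes. *)
apply/eqP; rewrite -subr_eq0 -linearB; apply/eqP/Jker0.
by rewrite linearB TST subrr.
Unshelve. all: by end_near. Qed.
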